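(* Let $k \ge 0$ be an integer. There exists an algebraic representation $\mathbf{A} = (A, F)$ of the lattice $N_k^*$ such that $A$ has $k+4$ elements and $F$ consists of $3k+4$ functions.
   Context: An algebraic structure is a pair $\mathbf{A} = (A, F)$ where $A$ is a set and $F$ is a set of functions (operations), each of the form $f : A^m \to A$ for some $m \in \mathbb{N} \cup \{0\}$ (the arity $m$ may depend on $f$; a nullary operation, $m=0$, is a distinguished constant in $A$). A subalgebra of $\mathbf{A}$ is a subset $B \subseteq A$ closed under every operation in $F$ (in particular containing every nullary constant), with the restricted operations. The subalgebras of $\mathbf{A}$, ordered by set inclusion, form a lattice $\mathbf{Sub}(\mathbf{A})$. An algebraic representation of a lattice $L$ is an algebraic structure $\mathbf{A}$ such that $\mathbf{Sub}(\mathbf{A})$ is isomorphic to $L$ as a lattice. The lattice $N_k^*$ has $k+4$ elements: a least element $0$, a greatest element $1$, a chain of $k$ elements $0 < b_k < \dots < b_1 < 1$, and two elements $a_1, a_2$ (strictly between $0$ and $1$) that are incomparable to each other and to every $b_i$, $i \in \{1, \dots, k\}$. (For $k = 0$ there are no elements $b_i$.) *)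

(* Defs.v *)
From HB Require Import structures.
From mathcomp Require Import all_boot all_order.
From mathcomp Require Import boolp classical_sets cardinality.

Set Implicit Arguments.
Unset Strict Implicit.
Unset Printing Implicit Defensive.

Import Order.TTheory.
Local Open Scope classical_set_scope.

(* Finitary operations T^m -> T, tagged with their arity m; for m = 0 the      *)
(* domain 0.-tuple T is a singleton, so the operation is a constant of T.      *)
Definition operation (T : Type) : Type := {m : nat & m.-tuple T -> T}.

Definition arity (T : Type) (f : operation T) : nat := tag f.

Definition apply_op (T : Type) (f : operation T) : (arity f).-tuple T -> T :=
  tagged f.

Record algebra : Type := Algebra {
  carrier :> Type;
  operations : set (operation carrier)
}.
Arguments operations : clear implicits.

Definition closed_under (T : Type) (f : operation T) (B : set T) : Prop :=
  forall t : (arity f).-tuple T, (forall i, B (tnth t i)) -> B (apply_op t).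

(* The empty set is a subalgebra exactly when there is no nullary operation.   *)
Definition is_subalgebra (A : algebra) (B : set A) : Prop :=
  forall f, operations A f -> closed_under f B.

Definition subalgebra (A : algebra) : Type :=
  {B : set A | `[< is_subalgebra B >]}.

Definition generated (A : algebra) (X : set A) : set A :=
  [set x | forall B : set A, is_subalgebra B -> X `<=` B -> B x].

Fact sub_display : Order.disp_t. Proof. exact: Order.Disp tt tt. Qed.

Section SubalgebraLattice.
Variable A : algebra.
Implicit Types (X Y Z : subalgebra A).

Lemma subalgebraP X : is_subalgebra (val X).
Proof. by have /asboolP := valP X. Qed.

Lemma is_subalgebraI X Y : `[< is_subalgebra (val X `&` val Y) >].
Proof.
apply/asboolP => f Ff t XYt; split.
  by apply: subalgebraP Ff _ _ => i; case: (XYt i).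
by apply: subalgebraP Ff _ _ => i; case: (XYt i).
Qed.

Lemma is_subalgebra_generated (X : set A) : `[< is_subalgebra (generated X) >].
Proof.
apply/asboolP => f Ff t gXt B subB XB.
by apply: (subB f Ff) => i; apply: gXt.
Qed.

HB.instance Definition _ := SubType.on (subalgebra A).
HB.instance Definition _ := Choice.on (subalgebra A).

HB.instance Definition _ := [SubChoice_isSubPOrder of subalgebra A by <: with
  sub_display].

Definition meet_sub X Y : subalgebra A :=
  exist _ (val X `&` val Y) (is_subalgebraI X Y).

Definition join_sub X Y : subalgebra A :=
  exist _ (generated (val X `|` val Y))
    (is_subalgebra_generated (val X `|` val Y)).

Lemma le_subE X Y : (X <= Y)%O = `[< val X `<=` val Y >].
Proof. by rewrite leEsub; apply/idP/asboolP; rewrite subsetEset. Qed.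

Lemma meet_subP X Y Z : (X <= meet_sub Y Z)%O = (X <= Y)%O && (X <= Z)%O.
Proof.
rewrite !le_subE; apply/asboolP/andP => [XYZ | [/asboolP XY /asboolP XZ]].
  by split; apply/asboolP => x /XYZ[].
by move=> x Xx; split; [apply: XY | apply: XZ].
Qed.

Lemma join_subP X Y Z : (join_sub X Y <= Z)%O = (X <= Z)%O && (Y <= Z)%O.
Proof.
rewrite !le_subE; apply/asboolP/andP => [XYZ | [/asboolP XZ /asboolP YZ]].
  by split; apply/asboolP => x ?; apply: XYZ => B _; apply; [left | right].
move=> x; apply; first exact: subalgebraP.
by move=> y [/XZ | /YZ].
Qed.

HB.instance Definition _ := Order.POrder_MeetJoin_isLattice.Build
  sub_display (subalgebra A) meet_subP join_subP.

End SubalgebraLattice.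

Definition lattice_isomorphic (d1 d2 : Order.disp_t)
    (L1 : latticeType d1) (L2 : latticeType d2) : Prop :=
  exists f : {lmorphism L1 -> L2}, bijective f.

Definition algebraic_representation (d : Order.disp_t) (L : latticeType d)
    (A : algebra) : Prop :=
  lattice_isomorphic (subalgebra A) L.

(* The lattice N_k^*; the chain b_1 > ... > b_k is indexed from 0, so that     *)
(* Nb i stands for b_(i+1) and a larger index means a smaller element.         *)
Inductive Nstar (k : nat) : Type := N0 | N1 | Na1 | Na2 | Nb of 'I_k.
Arguments N0 {k}.
Arguments N1 {k}.
Arguments Na1 {k}.
Arguments Na2 {k}.

Fact Nstar_display : Order.disp_t. Proof. exact: Order.Disp tt tt. Qed.

Section NstarLattice.
Variable k : nat.
Implicit Types x y z : Nstar k.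

Definition Nstar_code x : 'I_4 + 'I_k :=
  match x with
  | N0 => inl (inord 0) | N1 => inl (inord 1)
  | Na1 => inl (inord 2) | Na2 => inl (inord 3)
  | Nb i => inr i
  end.

Definition Nstar_decode (c : 'I_4 + 'I_k) : Nstar k :=
  match c with
  | inl j => nth N0 [:: N0; N1; Na1; Na2] j
  | inr i => Nb i
  end.

Lemma Nstar_codeK : cancel Nstar_code Nstar_decode.
Proof. by case=> //=; rewrite inordK. Qed.

HB.instance Definition _ := Finite.copy (Nstar k) (can_type Nstar_codeK).

Definition le_Nstar x y : bool :=
  match x, y with
  | N0, _ | _, N1 | Na1, Na1 | Na2, Na2 => true
  | Nb i, Nb j => (j <= i)%N
  | _, _ => false
  end.

Lemma le_Nstar_refl : reflexive le_Nstar.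
Proof. by case=> //= i. Qed.

Lemma le_Nstar_anti : antisymmetric le_Nstar.
Proof. by do 2!case=> [||||?] //=; move=> /anti_leq/val_inj->. Qed.

Lemma le_Nstar_trans : transitive le_Nstar.
Proof.
by do 3!case=> [||||?] //=; move=> ji kj; exact: leq_trans kj ji.
Qed.

HB.instance Definition _ := Order.Le_isPOrder.Build Nstar_display
  (Nstar k) le_Nstar_refl le_Nstar_anti le_Nstar_trans.

Definition meet_Nstar x y : Nstar k :=
  if (x <= y)%O then x else if (y <= x)%O then y else N0.

Definition join_Nstar x y : Nstar k :=
  if (x <= y)%O then y else if (y <= x)%O then x else N1.

Lemma meet_NstarP x y z : (x <= meet_Nstar y z)%O = (x <= y)%O && (x <= z)%O.
Proof.
rewrite /meet_Nstar; case: ifP => [yz | nyz].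
  by case xy: (x <= y)%O => //=; rewrite (le_trans xy yz).
case: ifP => [zy | nzy].
  by case xz: (x <= z)%O; rewrite ?andbF // (le_trans xz zy).
move: nyz nzy; rewrite /Order.le /=.
move: x y z; do 3!case=> [||||?] //=; rewrite ?andbF //.
by case: leqP => // /ltnW ->.
Qed.

Lemma join_NstarP x y z : (join_Nstar x y <= z)%O = (x <= z)%O && (y <= z)%O.
Proof.
rewrite /join_Nstar; case: ifP => [xy | nxy].
  by case yz: (y <= z)%O; rewrite ?andbF // (le_trans xy yz).
case: ifP => [yx | nyx].
  by case xz: (x <= z)%O => //=; rewrite (le_trans yx xz).
move: nxy nyx; rewrite /Order.le /=.
move: x y z; do 3!case=> [||||?] //=; rewrite ?andbF //.
by case: leqP => // /ltnW ->.
Qed.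

HB.instance Definition _ := Order.POrder_MeetJoin_isLattice.Build
  Nstar_display (Nstar k) meet_NstarP join_NstarP.

End NstarLattice.

(* Main.v *)
Require Import Defs.
From HB Require Import structures.
From mathcomp Require Import all_boot all_order.
From mathcomp Require Import boolp classical_sets cardinality.
From mathcomp Require Import zify.

Local Open Scope classical_set_scope.
Local Open Scope card_scope.

Set Implicit Arguments.
Unset Strict Implicit.
Unset Printing Implicit Defensive.
Import Order.TTheory.

(** A finite lattice [L] with [\bot != \top] is its own carrier for a
representation: it suffices to find operations on [L] whose closed sets are
exactly the principal ideals [{y | y <= x}], since these are ordered by
inclusion as [L] is.  Three kinds of operations are used:
- the constant [\bot], which excludes the empty set;
- for each [x] other than [\bot] and [\top], the unary [cut_op x], sending
  every [y] above [x] down to [x] and fixing the rest: closure under all of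
  these makes a set containing [\bot] downward closed;
- for each unordered pair of incomparable elements [p], [q], the binary
  [join_op (p, q)], sending [(p, q)] to [p `|` q] and acting as the first
  projection elsewhere: joins of comparable elements come for free, so these
  make a set closed under joins.
All of them preserve principal ideals, and conversely a closed set is a
nonempty downward closed set containing the join of its elements, i.e. the
ideal of that join ([subalgebra_ideal]).

These operations are pairwise distinct, so there are
[1 + (#|L| - 2) + #incomparable pairs] of them.  The lattice [N_k^*] has [k + 4]
elements and [2 k + 1] incomparable pairs, namely [(a_1, a_2)] and
[(b_i, a_j)]; this gives [(k + 3) + (2 k + 1) = 3 k + 4] operations. *)

(** Meets and joins are determined by the order: with [g] inverse to [f],
[f] and [g] are both left and right adjoint to each other. *)
Lemma lattice_isomorphic_of_le_mono (d1 d2 : Order.disp_t)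
    (L1 : latticeType d1) (L2 : latticeType d2) (f : L1 -> L2) (g : L2 -> L1) :
  cancel f g -> cancel g f -> {mono f : x y / (x <= y)%O} ->
  lattice_isomorphic L1 L2.
Proof.
move=> fK gK f_mono.
have le_gf u y : (u <= f y)%O = (g u <= y)%O by rewrite -{1}(gK u) f_mono.
have le_fg u x : (f x <= u)%O = (x <= g u)%O by rewrite -{1}(gK u) f_mono.
have fI : Order.meet_morphism f.
  move=> x y; apply/eqP; rewrite eq_le lexI !f_mono leIl leIr /=.
  by rewrite le_gf lexI -!le_gf leIl leIr.
have fU : Order.join_morphism f.
  move=> x y; apply/eqP; rewrite eq_le leUx !f_mono leUl leUr andbT.
  by rewrite le_fg leUx -!le_fg leUl leUr.
have f_homo : {homo f : x y / (x <= y)%O} by move=> x y; rewrite f_mono.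
pose f_ord : {omorphism L1 -> L2} :=
  HB.pack f (Order.isOrderMorphism.Build _ _ _ _ f f_homo).
pose f_lat : {lmorphism L1 -> L2} :=
  HB.pack f f_ord (Order.isLatticeMorphism.Build _ _ _ _ f_ord fI fU).
by exists f_lat; exists g.
Qed.

Lemma card_setT_finType (T : finType) : [set: T] #= `I_#|T|.
Proof.
have <- : range (fun x : T => val (enum_rank x)) = `I_#|T|.
  apply/seteqP; split=> [_ [x _ <-]|n ltn]; first exact: ltn_ord.
  by exists (enum_val (Ordinal ltn)); rewrite //= enum_valK.
apply/card_esym/inj_card_eq => x y _ _ /val_inj.
exact: enum_rank_inj.
Qed.

Section IdealAlgebra.
Variables (d : Order.disp_t) (L : finTBLatticeType d).
Variables (J : finType) (pq : J -> L * L).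
Implicit Types (x y : L) (B : set L).

Definition bot_op : operation L :=
  Tagged (fun m => m.-tuple L -> L) (fun _ : 0.-tuple L => \bot%O).

(** On a set closed under [cut_op x], having an element above [x] forces having
[x] itself, yet the value never exceeds the argument, so that ideals are
preserved. *)
Definition cut_op x : operation L :=
  Tagged (fun m => m.-tuple L -> L) (fun t : 1.-tuple L =>
    let y := tnth t ord0 in if (x <= y)%O then x else y).

(** Outside [p] the first argument is returned, which keeps every set closed, so
that the operation imposes the single condition that a set containing [p.1] and
[p.2] contain their join. *)
Definition join_op (p : L * L) : operation L :=
  Tagged (fun m => m.-tuple L -> L) (fun t : 2.-tuple L =>
    let x := tnth t ord0 in
    if (x, tnth t ord_max) == p then (p.1 `|` p.2)%O else x).

(** The cuts at [\bot] and [\top] would impose nothing new: the constant already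
provides [\bot], and only [\top] lies above [\top]. *)
Definition inner : Type := {x : L | (x != \bot%O) && (x != \top%O)}.

Definition ideal_op (i : option (inner + J)) : operation L :=
  match i with
  | None => bot_op
  | Some (inl x) => cut_op (val x)
  | Some (inr j) => join_op (pq j)
  end.

Definition ideal_algebra : algebra := Algebra (range ideal_op).

Definition ideal x : set L := [set y | (y <= x)%O].

Lemma ideal_subalgebra x : is_subalgebra (A := ideal_algebra) (ideal x).
Proof.
move=> _ [[[c|j]|] _ <-] t /= tx; rewrite /apply_op /ideal /=.
- by case: ifP => [/le_trans|_]; [apply|]; apply: tx.
- have := tx ord_max; have := tx ord0; rewrite /ideal /=.
  by case: eqP => [<- /=|_ //]; rewrite leUx => -> ->.
- exact: le0x.
Qed.

Hypothesis pq_total :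
  forall x y, (x >< y)%O -> exists j, pq j = (x, y) \/ pq j = (y, x).

(** A closed set is downward closed by the cuts and closed under finite joins by
the joins of incomparable pairs, hence contains the join of all its elements
and everything below it. *)
Lemma subalgebra_ideal B : is_subalgebra (A := ideal_algebra) B ->
  B = ideal (\join_(y | `[< B y >]) y)%O.
Proof.
move=> subB.
have B0 : B \bot%O.
  by apply: (subB bot_op _ [tuple]) => [|[]//]; exists None.
have B_down x y : B y -> (x <= y)%O -> B x.
  move=> By xy; have [->//|x0] := eqVneq x \bot%O.
  have [x1|x1] := eqVneq x \top%O.
    by move: xy; rewrite x1 le1x => /eqP <-.
  have xP : (x != \bot%O) && (x != \top%O) by rewrite x0.
  have cut_x : operations ideal_algebra (cut_op x).
    by exists (Some (inl (exist _ x xP))).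
  have /(_ [tuple y]) := subB _ cut_x.
  by rewrite /apply_op /= xy; apply=> i; rewrite (ord1 i).
have B_pair j : B (pq j).1 -> B (pq j).2 -> B ((pq j).1 `|` (pq j).2)%O.
  move=> B1 B2.
  have join_j : operations ideal_algebra (join_op (pq j)).
    by exists (Some (inr j)).
  have /(_ [tuple (pq j).1; (pq j).2]) := subB _ join_j.
  rewrite /apply_op /= -surjective_pairing (eqxx (pq j)); apply.
  by case=> [[|[|//]] lti].
have B_join x y : B x -> B y -> B (x `|` y)%O.
  move=> Bx By; have [/orP[xy|yx]|/pq_total [j pq_j]] := boolP (x >=< y)%O.
  - by rewrite join_r.
  - by rewrite join_l.
  - by case: pq_j (B_pair j) => -> /=; [|rewrite joinC]; apply.
apply/seteqP; split=> y /=.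
  by move=> By; apply: joins_sup; apply/asboolP.
apply: B_down; apply: (big_ind B) => // z; first by move/asboolP.
Qed.

Theorem ideal_algebra_representation : algebraic_representation L ideal_algebra.
Proof.
pose f (X : subalgebra ideal_algebra) : L := (\join_(y | `[< val X y >]) y)%O.
pose g x : subalgebra ideal_algebra :=
  exist _ (ideal x) (asboolT (@ideal_subalgebra x)).
have fK : cancel f g.
  move=> X; apply/val_inj; rewrite /= -subalgebra_ideal //.
  exact: subalgebraP.
have g_mono : {mono g : x y / (x <= y)%O}.
  move=> x y; rewrite le_subE; apply/asboolP/idP.
    by apply=> /=; exact: lexx.
  by move=> xy z /= /le_trans; apply.
have gK : cancel g f by move=> x; apply: (inc_inj g_mono); rewrite fK.
by apply: (lattice_isomorphic_of_le_mono fK gK) => X Y; rewrite -g_mono !fK.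
Qed.

Hypothesis pq_inj : injective pq.
Hypothesis pq_incomp : forall j, ((pq j).1 >< (pq j).2)%O.

(** The three kinds are separated by their arities.  The operation [cut_op x]
is recovered from its value [x] at [\top], and [join_op p] is the only one
of its kind whose value at [p] is not [p.1], because [p.2] is not below
[p.1]. *)
Lemma ideal_op_inj : injective ideal_op.
Proof.
have TagE n (u v : n.-tuple L -> L) :
    Tagged (fun m => m.-tuple L -> L) u = Tagged _ v -> u = v.
  by apply: (Eqdep_dec.inj_pair2_eq_dec _ (@eq_comparable nat)).
move=> [[x|i]|] [[y|j]|] // E; try by have := congr1 (@tag _ _) E.
- have /(congr1 (fun u => u [tuple \top%O])) := TagE _ _ _ E.
  by rewrite /= /tnth /= !lex1 => xy; have -> : x = y by apply: val_inj.
- have /(congr1 (fun u => u [tuple (pq i).1; (pq i).2])) := TagE _ _ _ E.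
  rewrite /tnth /= -surjective_pairing (eqxx (pq i)).
  case: eqP => [/pq_inj -> //|_ /eqP].
  have := pq_incomp i; rewrite eq_joinl /Order.comparable negb_or.
  by case/andP=> _ /negbTE ->.
Qed.

Lemma card_ideal_op : (\bot : L)%O != \top%O ->
  operations ideal_algebra #= `I_(#|L|.-1 + #|J|).
Proof.
move=> L01.
have -> : (#|L|.-1 + #|J|)%N = #|{: option (inner + J)}|.
  rewrite card_option card_sum card_sig -addSn; congr addn.
  (* The inner elements are the complement of the pair [\bot], [\top]. *)
  have /= <- := cardC (pred2 (\bot : L)%O \top%O).
  rewrite card2 L01 /= add1n; congr S; apply: eq_card => x.
  by rewrite !inE negb_or.
apply: card_eq_trans (card_setT_finType _).
by apply: inj_card_eq => ? ? _ _; apply: ideal_op_inj.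
Qed.

End IdealAlgebra.

Section NstarBounds.
Variable k : nat.

Lemma le_N0x (x : Nstar k) : (N0 <= x)%O.
Proof. by []. Qed.

Lemma le_xN1 (x : Nstar k) : (x <= N1)%O.
Proof. by case: x. Qed.

HB.instance Definition _ :=
  Order.hasBottom.Build Nstar_display (Nstar k) le_N0x.
HB.instance Definition _ := Order.hasTop.Build Nstar_display (Nstar k) le_xN1.

Lemma card_Nstar : #|{: Nstar k}| = (k + 4)%N.
Proof.
have decodeK : cancel (@Nstar_decode k) (@Nstar_code k).
  case=> [[[|[|[|[|//]]]] lti]|//] /=; congr inl; apply/val_inj; exact: inordK.
rewrite (bij_eq_card (Bijective (@Nstar_codeK k) decodeK)).
by rewrite card_sum !card_ord addnC.
Qed.

(** Each incomparable pair is listed once, in one of its two orders. *)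
Definition Nstar_pair (j : option ('I_k * bool)) : Nstar k * Nstar k :=
  match j with
  | None => (Na1, Na2)
  | Some (i, b) => (Nb i, if b then Na1 else Na2)
  end.

Lemma Nstar_pair_inj : injective Nstar_pair.
Proof. by case=> [[? []]|] [[? []]|] //; case=> ->. Qed.

Lemma Nstar_pair_incomp j : ((Nstar_pair j).1 >< (Nstar_pair j).2)%O.
Proof. by case: j => [[i []]|]. Qed.

Lemma Nstar_pair_total (x y : Nstar k) : (x >< y)%O ->
  exists j, Nstar_pair j = (x, y) \/ Nstar_pair j = (y, x).
Proof.
case: x y => [||||i] [||||i'] //; rewrite /Order.comparable /Order.le //=.
all: try by rewrite leq_total.
all: move=> _.
- by exists None; left.
- by exists (Some (i', true)); right.
- by exists None; right.
- by exists (Some (i', false)); right.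
- by exists (Some (i, true)); left.
- by exists (Some (i, false)); left.
Qed.

End NstarBounds.

Theorem proposition3 (k : nat) :
  exists A : algebra,
    [/\ algebraic_representation (Nstar k) A,
        [set: carrier A] #= `I_(k + 4)
      & operations A #= `I_(3 * k + 4)].
Proof.
exists (ideal_algebra (@Nstar_pair k)); split.
- exact: (ideal_algebra_representation (@Nstar_pair_total k)).
- by rewrite -(card_Nstar k); apply: card_setT_finType.
- have N01 : (\bot : Nstar k)%O != \top%O by apply/eqP.
  have := card_ideal_op (@Nstar_pair_inj k) (@Nstar_pair_incomp k) N01.
  rewrite card_option card_prod card_ord card_bool card_Nstar.
  by have -> : ((k + 4).-1 + (k * 2).+1 = 3 * k + 4)%N by lia.
Qed.
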